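(* Let $n$ and $k$ be positive integers and let $x$ be an integer with $$0\le x \le \binom{n}{\left\lfloor \frac{n}{2}\right\rfloor + (-1)^k\left\lfloor \frac{k}{2}\right\rfloor}.$$ Let $F=\mathcal{B}(n,k-1)\cup X$, where $X$ consists of exactly $x$ sets from the $k$th middle row $\mathcal{B}(n,k)\setminus\mathcal{B}(n,k-1)$. Then $|F|=x+\Sigma(n,k-1)$, the family $F$ contains exactly $$x\cdot\prod_{i=1}^{k-1}\left(\left\lfloor\frac{n+k}{2}\right\rfloor-i+1\right)$$ copies of $\mathcal{P}_k$, and this is the minimum number of copies of $\mathcal{P}_k$ over all families of $x+\Sigma(n,k-1)$ subsets of $[n]=\{1,\dots,n\}$.
   Context: For a set $S$, $\binom{S}{j}$ denotes the collection of all $j$-element subsets of $S$ (empty if $j<0$ or $j>|S|$), and $\binom{n}{j}=0$ if $j<0$ or $j>n$. For an integer $m\ge 0$, $\mathcal{B}(n,m)$ denotes a family of all subsets of $[n]$ of the $m$ middle sizes, i.e. either $$\mathcal{B}(n,m)=\binom{[n]}{\lfloor (n-m+1)/2\rfloor}\cup\cdots\cup\binom{[n]}{\lfloor (n+m-1)/2\rfloor}$$ or $$\mathcal{B}(n,m)=\binom{[n]}{\lceil (n-m+1)/2\rceil}\cup\cdots\cup\binom{[n]}{\lceil (n+m-1)/2\rceil}.$$ (Depending on the parity of $n$ and $m$, these are one or two different families; they have the same size. For $m=0$ the family is empty.) Where there is a choice for $\mathcal{B}(n,k-1)$ or $\mathcal{B}(n,k)$, any choice may be made; $\mathcal{B}(n,k-1)\subseteq\mathcal{B}(n,k)$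 always holds. $\Sigma(n,m)=|\mathcal{B}(n,m)|$ denotes the common size; in particular $\Sigma(n,0)=0$. $\mathcal{P}_k$ denotes the $k$-element totally ordered set (chain). Families of subsets are ordered by inclusion, and a copy of $\mathcal{P}_k$ in a family is a set of $k$ of its members that is totally ordered by inclusion. An empty product equals $1$. *)

(* Defs.v *)
From mathcomp Require Import all_boot all_order all_algebra zify.

Set Implicit Arguments.
Unset Strict Implicit.
Unset Printing Implicit Defensive.

Import Order.TTheory GRing.Theory Num.Theory.
Local Open Scope ring_scope.

(* The ground set [n] is 'I_n.  Row indices are integers, because the bounds  *)
(* of B(n, m) leave {0, ..., n} when m > n + 1.                               *)

Definition binz (n : nat) (j : int) : nat :=
  if j is Posz i then 'C(n, i) else 0%N.

(* divz rounds towards -oo for a positive divisor. *)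
Definition floor_half (z : int) : int := (z %/ 2)%Z.
Definition ceil_half (z : int) : int := - floor_half (- z).

(* The union of the rows of index a, a + 1, ..., b; empty if b < a. *)
Definition rows (n : nat) (a b : int) : {set {set 'I_n}} :=
  [set A : {set 'I_n} | a <= #|A|%:Z <= b].

Definition Bfloor (n m : nat) : {set {set 'I_n}} :=
  rows n (floor_half (n%:Z - m%:Z + 1)) (floor_half (n%:Z + m%:Z - 1)).

Definition Bceil (n m : nat) : {set {set 'I_n}} :=
  rows n (ceil_half (n%:Z - m%:Z + 1)) (ceil_half (n%:Z + m%:Z - 1)).

Definition is_middle (n m : nat) (B : {set {set 'I_n}}) : Prop :=
  B = Bfloor n m \/ B = Bceil n m.

Definition Sigma (n m : nat) : nat := #|Bfloor n m|.

Lemma is_middle_card (n m : nat) (B : {set {set 'I_n}}) :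
  is_middle m B -> #|B| = Sigma n m.
Proof.
case=> -> //; rewrite /Sigma -(card_imset _ (@setC_inj 'I_n)).
congr #|pred_of_set _|; apply/setP=> A.
rewrite -{1}[A]setCK mem_imset ?inE; last exact: setC_inj.
have := cardsC A; rewrite card_ord => An.
by apply/idP/idP; rewrite /ceil_half /floor_half; lia.
Qed.

(* A copy of the chain P_k in F, as a set of k members of F. *)
Definition is_chain_copy (n k : nat) (F C : {set {set 'I_n}}) : bool :=
  [&& C \subset F, #|C| == k &
      [forall A in C, forall B in C, (A \subset B) || (B \subset A)]].

Definition num_chains (n k : nat) (F : {set {set 'I_n}}) : nat :=
  #|[set C : {set {set 'I_n}} | is_chain_copy k F C]|.

(* Main.v *)
(** Every permutation of [n] encodes a maximal chain of subsets.  Truncate each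
    of them to the levels i, ..., n - i, with weight 'C(n, i) - 'C(n, i - 1), for
    all i <= n / 2: every subset is then covered with total weight n!, so that
    this is a fractional version of a symmetric chain decomposition.  A chain
    with g members in G contains 'C(g, k) >= g - (k - 1) copies of P_k, and a
    truncated chain lies in or crosses the k - 1 middle rows; hence the copies
    of P_k in G have total weight at least n! (#|G| - Sigma n (k - 1)).

    Let t = (n + k) / 2.  A copy of P_k that does not contain both the empty set
    and [n] has weight at most n! / (t (t - 1) ... (t - k + 2)), which gives the
    lower bound when G misses one of these two sets.  Otherwise, remove the
    empty set from G, and apply this case to the rest twice: to its copies of
    P_k, and to its copies of P_(k - 1), which the empty set extends to copies
    of P_k in G.

    For the family F of the theorem it only remains to bound the number of copies
    from above: up to complement, F consists of k consecutive rows of which X is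
    the top one, so that a copy of P_k is a saturated chain descending from a
    member of X, which has t elements. *)

Require Import Defs.
From mathcomp Require Import all_boot all_order all_algebra all_fingroup zify.

Import GRing.Theory.

Set Implicit Arguments.
Unset Strict Implicit.
Unset Printing Implicit Defensive.

Lemma leq_mul_fact p q : 0 < p -> 0 < q -> p`! * q`! <= (p + q).-1`!.
Proof.
move=> p_gt0; elim: q => [//|[_ _|q IHq _]]; first by rewrite muln1 addn1.
rewrite factS mulnCA addnS /= addnS factS.
by apply: leq_mul; [lia | have := IHq isT; rewrite addnS].
Qed.

Lemma leq_ffact2l m p k : m <= p -> m ^_ k <= p ^_ k.
Proof.
elim: k m p => [|k IHk] [|m] [|p] // le_mp.
by rewrite !ffactSS; apply: leq_mul => //; apply: IHk.
Qed.

Lemma leq_binS n i : i.*2 < n -> 'C(n, i) <= 'C(n, i.+1).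
Proof.
move=> lt_in; rewrite -(@leq_pmul2l i.+1) // mul_bin_left.
by apply: leq_mul => //; lia.
Qed.

Lemma leqn_bin n j : 0 < j < n -> n <= 'C(n, j).
Proof.
elim: n j => [|n IHn] [|j] //= lt_jn; rewrite binS.
have Cnj_gt0 : 0 < 'C(n, j) by rewrite bin_gt0; lia.
case: (ltnP j.+1 n) => [lt_j1n | le_nj]; first by have := IHn j.+1 lt_j1n; lia.
have -> : n = j.+1 by lia.
by rewrite binn -[X in _ + X](@bin_sub j.+1 j) // subSnn bin1.
Qed.

Lemma leq_binS_addn g k : g <= 'C(g, k.+1) + k.
Proof.
elim: g => [|g IHg] //; rewrite binS.
case: (leqP k g) => [le_kg | lt_gk]; last by lia.
have : 0 < 'C(g, k) by rewrite bin_gt0.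
by lia.
Qed.

Lemma leq_ffact_half n k : k < n ->
  (n + k.+2)./2 ^_ k.+1 <= 'C(n, (n + k.+1)./2) * (n + k.+1)./2 ^_ k.
Proof.
move=> lt_kn; case: (eqVneq k.+1 n) => [<- | ne_kn].
  have [-> ->] : (k.+1 + k.+2)./2 = k.+1 /\ (k.+1 + k.+1)./2 = k.+1 by lia.
  by rewrite binn mul1n ffactnSr subSnn muln1.
rewrite ffactnS; apply: leq_mul.
  by apply: leq_trans (_ : n <= _); [lia | apply: leqn_bin; lia].
by apply: leq_ffact2l; lia.
Qed.

Lemma leq_card_bigcup (I T : finType) (P : pred I) (S : I -> {set T}) :
  #|\bigcup_(i | P i) S i| <= \sum_(i | P i) #|S i|.
Proof.
elim/big_rec2: _ => [|i m X _ le_Xm]; first by rewrite cards0.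
by apply: leq_trans (leq_card_setU _ _) _; rewrite leq_add2l.
Qed.

Section Chains.

Variable T : finType.
Implicit Types (A B : {set T}) (C : {set {set T}}).

Definition chain C :=
  [forall A in C, forall B in C, (A \subset B) || (B \subset A)].

Lemma chainP C :
  reflect {in C &, forall A B, (A \subset B) || (B \subset A)} (chain C).
Proof.
apply: (iffP forall_inP) => [chainC A B inA inB | chainC A inA].
  exact: (forall_inP (chainC A inA)).
by apply/forall_inP=> B; apply: chainC.
Qed.

Lemma chainS C C' : C' \subset C -> chain C -> chain C'.
Proof. by move=> /subsetP sC /chainP chC; apply/chainP; apply: sub_in2 chC. Qed.

Lemma chain_leq_card C :
  chain C -> {in C &, forall A B, (#|A| <= #|B|) = (A \subset B)}.
Proof.
move=> /chainP chainC A B inA inB; apply/idP/idP => [le_AB|].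
  case/orP: (chainC _ _ inA inB) => // sBA.
  by rewrite -(eqP (_ : B == A)) // eqEcard sBA.
exact: subset_leq_card.
Qed.

Lemma chain_card_inj C : chain C -> {in C &, injective (fun A => #|A|)}.
Proof.
move=> chainC A B inA inB eqAB; apply/eqP.
by rewrite eqEsubset -!(chain_leq_card chainC) // eqAB leqnn.
Qed.

Lemma leq_card_chain C lo hi :
  chain C -> {in C, forall A, lo <= #|A| <= hi} -> #|C| <= hi.+1 - lo.
Proof.
move=> chainC range; rewrite cardE -(size_map (fun A : {set T} => #|A|)).
rewrite -[leqRHS](size_iota lo); apply: uniq_leq_size.
  rewrite map_inj_in_uniq ?enum_uniq // => A B; rewrite !mem_enum.
  exact: chain_card_inj.
move=> m /mapP[A]; rewrite mem_enum => /range inA ->.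
by rewrite mem_iota; lia.
Qed.

Lemma leq_card_nonempty_chain C B : chain C -> set0 \notin C ->
  {in C, forall A, A \subset B} -> #|C| <= #|B|.
Proof.
move=> chainC C0 topB; rewrite -[leqRHS](subn1 #|B|.+1).
apply: leq_card_chain => // A inA; rewrite subset_leq_card ?topB // andbT.
by rewrite card_gt0; apply: contraNneq C0 => <-.
Qed.

Lemma chain_topP C : chain C -> C != set0 ->
  exists2 B, B \in C & {in C, forall A, A \subset B}.
Proof.
move=> chainC /set0Pn[B0 B0C]; exists [arg max_(B > B0 in C) #|B|].
  by case: arg_maxnP.
move=> A inA; case: arg_maxnP => // B inB maxB.
by rewrite -(chain_leq_card chainC) //; apply: maxB.
Qed.

Definition compl C := (@setC T) @: C.

Lemma mem_compl C A : (A \in compl C) = (~: A \in C).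
Proof. by rewrite -{1}[A]setCK mem_imset //; apply: setC_inj. Qed.

Lemma card_compl C : #|compl C| = #|C|.
Proof. by rewrite card_imset //; apply: setC_inj. Qed.

Lemma complK : involutive compl.
Proof. by move=> C; apply/setP => A; rewrite !mem_compl setCK. Qed.

Lemma chain_compl C : chain C -> chain (compl C).
Proof.
move=> /chainP chainC; apply/chainP => A B; rewrite !mem_compl => inA inB.
by rewrite -!(setCS A) -!(setCS B) orbC; apply: chainC.
Qed.

End Chains.

Section ChainCopies.

Variable T : finType.
Implicit Types (A B : {set T}) (C F G X : {set {set T}}).

Definition chain_copies k F : {set {set {set T}}} :=
  [set C : {set {set T}} | [&& C \subset F, #|C| == k & chain C]].

Lemma chain_copiesP k F C :
  reflect [/\ C \subset F, #|C| = k & chain C] (C \in chain_copies k F).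
Proof. by rewrite inE; apply: (iffP and3P) => -[? /eqP]. Qed.

Lemma leq_card_chain_copies1 F : #|F| <= #|chain_copies 1 F|.
Proof.
rewrite -(card_imset _ (@set1_inj _)); apply/subset_leq_card/subsetP.
move=> _ /imsetP[A inA ->]; apply/chain_copiesP; split; rewrite ?sub1set ?cards1 //.
by apply/chainP => _ _ /set1P-> /set1P->; rewrite subxx.
Qed.

Lemma leq_card_chain_copies_compl k F :
  #|chain_copies k F| <= #|chain_copies k (compl F)|.
Proof.
rewrite -(card_imset _ (can_inj (@complK T))); apply/subset_leq_card/subsetP.
move=> _ /imsetP[C /chain_copiesP[sCF cardC chainC] ->].
by apply/chain_copiesP; split; rewrite ?card_compl ?imsetS ?chain_compl.
Qed.

Lemma card_chain_copies_compl k F :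
  #|chain_copies k (compl F)| = #|chain_copies k F|.
Proof.
apply/eqP; rewrite eqn_leq leq_card_chain_copies_compl.
by rewrite -{2}[F]complK leq_card_chain_copies_compl.
Qed.

Lemma leq_card_chain_copies_set0 k G : set0 \in G ->
  #|chain_copies k.+1 (G :\ set0)| + #|chain_copies k (G :\ set0)|
    <= #|chain_copies k.+1 G|.
Proof.
move=> inG; have sG : G :\ set0 \subset G by apply: subD1set.
rewrite addnC -[leqRHS](cardsID [set C : {set {set T}} | set0 \in C]).
apply: leq_add.
  have inj : {in chain_copies k (G :\ set0) &, injective (setU [set set0])}.
    move=> C C' /chain_copiesP[/subsetD1P[_ nC] _ _].
    move=> /chain_copiesP[/subsetD1P[_ nC'] _ _] eqCC'.
    by rewrite -(setU1K nC) eqCC' setU1K.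
  rewrite -(card_in_imset inj); apply/subset_leq_card/subsetP.
  move=> _ /imsetP[C /chain_copiesP[/subsetD1P[sCG nC] cardC /chainP chainC] ->].
  rewrite in_setI [X in _ && X]inE setU11 andbT; apply/chain_copiesP; split.
  - by rewrite subUset sub1set inG.
  - by rewrite cardsU1 nC cardC.
  - apply/chainP => A B /setU1P[->|inA] /setU1P[->|inB]; rewrite ?sub0set ?orbT //.
    exact: chainC.
apply/subset_leq_card/subsetP => C /chain_copiesP[/subsetD1P[sCG nC] cardC chainC].
by rewrite in_setD [X in ~~ X]inE nC; apply/chain_copiesP.
Qed.

(* The k + 1 members occupy all the levels t - k, ..., t. *)
Lemma chain_full_top t k C : chain C -> #|C| = k.+1 ->
    {in C, forall A, #|A| <= t <= #|A| + k} ->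
  exists2 A, A \in C & #|A| = t /\ {in C, forall B, B \subset A}.
Proof.
move=> chainC cardC levC.
have [|A inA topA] := chain_topP chainC; first by rewrite -card_gt0 cardC.
exists A => //; split=> //.
have : #|C| <= #|A|.+1 - (t - k).
  apply: leq_card_chain => // B inB; rewrite subset_leq_card ?topA // andbT.
  by have := levC B inB; lia.
by have := levC A inA; lia.
Qed.

Definition upper_subsets k A := [set B : {set T} in powerset A | #|A| <= #|B| + k].

Lemma upper_subsetsP k A B :
  reflect (B \subset A /\ #|A| <= #|B| + k) (B \in upper_subsets k A).
Proof. by rewrite !inE; apply: andP. Qed.

Lemma chain_copies_upper_top k A C :
  C \in chain_copies k.+1 (upper_subsets k A) -> A \in C.
Proof.
case/chain_copiesP => /subsetP sC cardC chainC.
have [|B inB [cardB _]] := @chain_full_top #|A| k C chainC cardC.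
  by move=> B /sC/upper_subsetsP[/subset_leq_card-> ->].
have /upper_subsetsP[sBA _] := sC B inB.
by rewrite -(eqP (_ : B == A)) // eqEcard sBA cardB leqnn.
Qed.

Lemma chain_copies_upper_setD1 k A C :
    C \in chain_copies k.+2 (upper_subsets k.+1 A) ->
  exists2 x, x \in A & C :\ A \in chain_copies k.+1 (upper_subsets k (A :\ x)).
Proof.
move=> /[dup] /chain_copies_upper_top inA /chain_copiesP[/subsetP sC cardC chainC].
have cardC' : #|C :\ A| = k.+1 by move: cardC; rewrite (cardsD1 A) inA => -[].
have chainC' : chain (C :\ A) by apply: chainS chainC; apply: subD1set.
have lev B : B \in C :\ A -> (B \proper A) && (#|A| <= #|B| + k.+1).
  by move=> /setD1P[nBA /sC/upper_subsetsP[sBA ->]]; rewrite properEneq nBA sBA.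
have [|B inB [cardB topB]] := @chain_full_top #|A|.-1 k (C :\ A) chainC' cardC'.
  by move=> B /lev/andP[/proper_card lt_BA le_AB]; lia.
have /andP[/[dup] /proper_sub sBA /proper_card lt_BA _] := lev B inB.
have /cards1P[x defx] : #|A :\: B| == 1 by rewrite cardsDS //; apply/eqP; lia.
have defB : A :\ x = B by rewrite -defx setDDr setDv set0U; apply/setIidPr.
exists x; first by have := set11 x; rewrite -defx inE => /andP[].
apply/chain_copiesP; split=> //; apply/subsetP => D inD.
apply/upper_subsetsP; rewrite defB topB //; split=> //.
by have /andP[_ le_AD] := lev D inD; lia.
Qed.

Lemma leq_card_chain_copies_upper k A :
  #|chain_copies k.+1 (upper_subsets k A)| <= #|A| ^_ k.
Proof.
elim: k A => [|k IHk] A.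
  rewrite ffactn0 -[leqRHS](cards1 [set A]); apply/subset_leq_card/subsetP => C.
  move=> /[dup] /chain_copies_upper_top inA.
  case/chain_copiesP => _ /eqP/cards1P[B defC] _.
  by move: inA; rewrite defC !inE => /eqP->.
rewrite ffactnS -sum_nat_const.
apply: leq_trans (_ : \sum_(x in A)
  #|setU [set A] @: chain_copies k.+1 (upper_subsets k (A :\ x))| <= _).
  apply: leq_trans (leq_card_bigcup _ _); apply/subset_leq_card/subsetP => C inK.
  have [x inx inKx] := chain_copies_upper_setD1 inK.
  apply/bigcupP; exists x => //; apply/imsetP; exists (C :\ A) => //.
  by rewrite setD1K // (chain_copies_upper_top inK).
apply: leq_sum => x inx; apply: leq_trans (leq_imset_card _ _) _.
by apply: leq_trans (IHk _) _; rewrite (cardsD1 x A) inx.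
Qed.

Definition top_layer k t F X :=
  {in F, forall A, #|A| < t <= #|A| + k} /\ {in X, forall A, #|A| = t}.

Lemma leq_card_chain_copies_top_layer k t F X : top_layer k t F X ->
  #|chain_copies k.+1 (F :|: X)| <= #|X| * t ^_ k.
Proof.
move=> [levF levX]; rewrite -sum_nat_const.
apply: leq_trans (_ : \sum_(A in X) #|chain_copies k.+1 (upper_subsets k A)| <= _).
  apply: leq_trans (leq_card_bigcup _ _); apply/subset_leq_card/subsetP.
  move=> C /chain_copiesP[/subsetP sC cardC chainC].
  have lev A : A \in C -> #|A| <= t <= #|A| + k.
    by move/sC/setUP => [/levF | /levX]; lia.
  have [A inA [cardA topA]] := chain_full_top chainC cardC lev.
  have inX : A \in X by case/setUP: (sC A inA) => // /levF; lia.
  apply/bigcupP; exists A => //; apply/chain_copiesP; split=> //.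
  apply/subsetP => B inB; apply/upper_subsetsP; split; first exact: topA.
  by rewrite cardA; case/andP: (lev B inB).
by apply: leq_sum => A /levX <-; apply: leq_card_chain_copies_upper.
Qed.

End ChainCopies.

Section ChainStabilizers.

Local Open Scope group_scope.

Variable T : finType.
Implicit Types (A B D : {set T}) (C : {set {set T}}) (p : {perm T}).

Lemma astab_Sym_setT C : 'C_(Sym setT)(C | 'P^* ) = 'C(C | 'P^* ).
Proof. by apply/setIidPr/subsetP => p _; rewrite inE; apply/subsetP. Qed.

(* Restriction to A maps this stabilizer to that of C in Sym A, and the
   permutations in its kernel only move points of D :\: A. *)
Lemma leq_card_astab_Sym_setU1 D A C : {in C, forall A', A' \subset A} ->
  (#|'C_(Sym D)(A |: C | 'P^* )| <= #|'C_(Sym A)(C | 'P^* )| * #|D :\: A|`!)%N.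
Proof.
move=> sCA; set H := 'C_(Sym D)(A |: C | 'P^* ).
have sHN : H \subset 'N(A | 'P).
  rewrite -astab1_set; apply: subset_trans (subsetIr _ _) _.
  by apply: astabS; rewrite sub1set setU11.
have ker_sub : 'ker_H (restr_perm A) \subset Sym (D :\: A).
  rewrite ker_restr_perm /H !SymE setDE setCI setCK (astabU _ (~: D)).
  by rewrite setSI ?subsetIl.
have im_sub : restr_perm A @* H \subset 'C_(Sym A)(C | 'P^* ).
  apply/subsetP => _ /morphimP[p pN pH ->]; rewrite inE; apply/andP; split.
    by rewrite inE; apply: restr_perm_on.
  apply/astabP => A' inA'.
  have /setIP[_ /astabP fixp] := pH; rewrite -[RHS]fixp ?setU1r //.
  apply: eq_in_imset => x xA'; rewrite /= /aperm restr_permE //.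
  exact: (subsetP (sCA _ inA')).
rewrite -(LagrangeI H ('ker (restr_perm A))) mulnC.
rewrite -card_Sym leq_mul ?subset_leq_card //.
apply: leq_trans (subset_leq_card im_sub).
by rewrite card_morphim (setIidPr sHN).
Qed.

Lemma setact_permE p A : ('P^* )%act A p = p @: A.
Proof. by []. Qed.

Lemma card_orbit_astab1_set A :
  (#|orbit 'P^* [set: {perm T}] A| * #|'C[A | 'P^* ]| = #|T|`!)%N.
Proof.
have := card_orbit_stab 'P^* [set: {perm T}]%G A; rewrite setTI => ->.
rewrite -(cardsT T) -card_Sym; apply: eq_card => p.
by rewrite !inE; apply/esym/subsetP.
Qed.

Lemma orbit_set_perm A :
  orbit 'P^* [set: {perm T}] A = [set B : {set T} | #|B| == #|A|].
Proof.
apply/eqP; rewrite eqEcard card_draws; apply/andP; split.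
  apply/subsetP => _ /orbitP[p _ <-].
  by rewrite inE setact_permE card_imset //; apply: perm_inj.
have fact2_gt0 : (0 < #|A|`! * (#|T| - #|A|)`!)%N by rewrite muln_gt0 !fact_gt0.
rewrite -(leq_pmul2r fact2_gt0) bin_fact ?max_card // -(card_orbit_astab1_set A).
rewrite leq_mul2l; apply/orP; right.
rewrite -astab_Sym_setT -[[set A]]setU0.
apply: leq_trans (@leq_card_astab_Sym_setU1 _ _ _ _) _ => [B|].
  by rewrite inE.
rewrite cardsDS ?subsetT // cardsT leq_mul2r.
by rewrite -card_Sym subset_leq_card ?subsetIl ?orbT.
Qed.

Lemma card_astab1_set A : (#|'C[A | 'P^* ]| = #|A|`! * (#|T| - #|A|)`!)%N.
Proof.
have le_AT : (#|A| <= #|T|)%N by apply: max_card.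
apply/eqP; rewrite -(@eqn_pmul2l 'C(#|T|, #|A|)) ?bin_gt0 // bin_fact //.
by rewrite -card_draws -orbit_set_perm card_orbit_astab1_set.
Qed.

Lemma leq_card_astab_chain D B C :
  chain C -> set0 \notin C -> B \in C -> {in C, forall A, A \subset B} ->
  (#|'C_(Sym D)(C | 'P^* )| <= (#|B| - #|C|.-1)`! * #|D :\: B|`!)%N.
Proof.
have [m] := ubnP #|C|; elim: m D B C => // m IHm D B C lt_Cm chainC C0 inB topB.
have cardC : #|C|.-1 = #|C :\ B| by rewrite (cardsD1 B) inB.
have chainC' : chain (C :\ B) by apply: chainS chainC; apply: subD1set.
rewrite cardC -[in X in (X <= _)%N](setD1K inB).
apply: leq_trans (leq_card_astab_Sym_setU1 _ _) _ => [A /setD1P[_ /topB] //|].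
rewrite leq_mul2r; apply/orP; right.
case: (eqVneq (C :\ B) set0) => [-> | C'_neq0].
  by rewrite cards0 subn0 -card_Sym subset_leq_card ?subsetIl.
have [A inA topA] := chain_topP chainC' C'_neq0.
have pAB : A \proper B.
  by move: inA => /setD1P[nAB inA]; rewrite properEneq nAB topB.
have C'0 : set0 \notin C :\ B by rewrite inE negb_and C0 orbT.
have le_C'A := leq_card_nonempty_chain chainC' C'0 topA.
have lt_AB := proper_card pAB; have card_BA := cardsDS (proper_sub pAB).
have C'_gt0 : (0 < #|C :\ B|)%N by rewrite card_gt0.
apply: leq_trans (IHm B A (C :\ B) _ chainC' C'0 inA topA) _; first by lia.
apply: leq_trans (leq_mul_fact _ _) _; [lia | lia | apply: eq_leq; congr _`!; lia].
Qed.

Lemma astab_compl C : 'C(compl C | 'P^* ) = 'C(C | 'P^* ).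
Proof.
suff sub C' : 'C(C' | 'P^* ) \subset 'C(compl C' | 'P^* ).
  by apply/eqP; rewrite eqEsubset sub andbT -{2}[C]complK sub.
apply/subsetP => p /astabP fixp; apply/astabP => A; rewrite mem_compl.
by move=> /fixp/astab1P; rewrite astab1_set astabsC -astab1_set => /astab1P.
Qed.

(* #|'C(C | 'P^* )| * 'C(#|T|, #|A|) will bound the total weight of the truncated
   flags through C. *)
Definition light m C := exists2 A, A \in C
  & (#|'C(C | 'P^* )| * 'C(#|T|, #|A|) * m ^_ #|C|.-1 <= #|T|`!)%N.

Lemma chain_light_top m C A :
  chain C -> set0 \notin C -> A \in C -> (m <= #|A|)%N -> light m C.
Proof.
move=> chainC C0 inA le_mA.
have [|B inB topB] := chain_topP chainC; first by apply/set0Pn; exists A.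
have le_mB : (m <= #|B|)%N by rewrite (leq_trans le_mA) ?subset_leq_card ?topB.
have le_CB : (#|C|.-1 <= #|B|)%N.
  exact: leq_trans (leq_pred _) (leq_card_nonempty_chain chainC C0 topB).
have le_BT : (#|B| <= #|T|)%N by apply: max_card.
have := leq_card_astab_chain [set: T] chainC C0 inB topB.
rewrite astab_Sym_setT cardsDS ?subsetT // cardsT => stab_le.
exists B => //.
apply: leq_trans (leq_mul (leq_mul stab_le (leqnn _)) (leq_ffact2l _ le_mB)) _.
by rewrite -(bin_fact le_BT) -(ffact_fact le_CB); apply: eq_leq; lia.
Qed.

Lemma chain_light_bottom m C A :
  chain C -> setT \notin C -> A \in C -> (m <= #|~: A|)%N -> light m C.
Proof.
move=> chainC CT inA le_mA.
have [|||B] := @chain_light_top m (compl C) (~: A) (chain_compl chainC).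
- by rewrite mem_compl setC0.
- by rewrite mem_compl setCK.
- by [].
rewrite mem_compl astab_compl card_compl => inB boundB; exists (~: B) => //.
by rewrite [#|~: B|]cardsCs setCK bin_sub ?max_card.
Qed.

Lemma chain_light_half C : chain C -> C != set0 ->
  (set0 \notin C) || (setT \notin C) -> light (#|T| + #|C|)./2 C.
Proof.
move=> chainC C_neq0 C0T; set t := (_ + _)./2.
have C_gt0 : (0 < #|C|)%N by rewrite card_gt0.
have card_T A : (#|A| + #|~: A| = #|T|)%N by apply: cardsC.
have le_CT : (#|C| <= #|T|.+1 - 0)%N.
  by apply: leq_card_chain => // A _; rewrite max_card.
case: (boolP (set0 \in C)) C0T => [in0 /= CT | C0 _].
  by apply: (chain_light_bottom chainC CT in0); rewrite setC0 cardsT /t; lia.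
case: (boolP (setT \in C)) => [inT | CT].
  by apply: (chain_light_top chainC C0 inT); rewrite cardsT /t; lia.
case: (boolP [exists A in C, (t <= #|A|)%N]) => [/exists_inP[A] | no_top].
  exact: chain_light_top.
case: (boolP [exists A in C, (t <= #|~: A|)%N]) => [/exists_inP[A] | no_bottom].
  exact: chain_light_bottom.
suff : (#|C| <= t.-1.+1 - (#|T|.+1 - t))%N by rewrite /t; lia.
apply: leq_card_chain => // A inA; have := card_T A.
move/exists_inPn: no_top => /(_ A inA).
by move/exists_inPn: no_bottom => /(_ A inA); lia.
Qed.

End ChainStabilizers.

Lemma exchange_sum_weight (I J : finType) (w : I -> nat) (R : I -> pred J)
    (P : {set J}) :
  \sum_(j in P) \sum_(i | R i j) w i = \sum_i w i * #|[set j in P | R i j]|.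
Proof.
rewrite (exchange_big_dep predT) //=; apply: eq_bigr => i _.
by rewrite sum_nat_const mulnC; congr (_ * _); apply: eq_card => j; rewrite !inE.
Qed.

Lemma leq_weighted_cover (I T : finType) (w : I -> nat) (D : I -> {set T})
    (G M : {set T}) (K : {set {set T}}) N k m :
    0 < N -> (forall x, \sum_(i | x \in D i) w i = N) ->
    (forall i, (D i \subset M) || (k <= #|M :&: D i|)) ->
    (forall i (C : {set T}), C \subset G :&: D i -> #|C| = k.+1 -> C \in K) ->
    {in K, forall C : {set T}, (\sum_(i | C \subset D i) w i) * m <= N} ->
  (#|G| - #|M|) * m <= #|K|.
Proof.
move=> N_gt0 coverN meetM subK weightK.
have sum_points (S : {set T}) : \sum_i w i * #|S :&: D i| = #|S| * N.
  rewrite -sum_nat_const -(eq_bigr _ (fun x _ => coverN x)) exchange_sum_weight.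
  by apply: eq_bigr => i _; congr (_ * _); apply: eq_card => x; rewrite !inE.
have many_subsets i :
    #|G :&: D i| <= #|[set C in K | C \subset D i]| + #|M :&: D i|.
  case/orP: (meetM i) => [/setIidPr-> | le_kM].
    by apply: leq_trans (leq_addl _ _); rewrite subset_leq_card ?subsetIr.
  apply: leq_trans (leq_binS_addn _ k) _; apply: leq_add => //.
  rewrite -cards_draws subset_leq_card //; apply/subsetP => C; rewrite !inE.
  case/andP=> sC /eqP cardC; rewrite (subK i) ?sC //=.
  by apply: subset_trans sC _; apply: subsetIr.
rewrite -(leq_pmul2r N_gt0) mulnAC -[leqRHS]sum_nat_const.
apply: leq_trans (_ : \sum_(C in K) (\sum_(i | C \subset D i) w i) * m <= _).
  rewrite -big_distrl /= leq_mul2r; apply/orP; right.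
  rewrite exchange_sum_weight mulnBl -!sum_points leq_subLR -big_split.
  by apply: leq_sum => i _ /=; rewrite -mulnDr leq_mul2l addnC many_subsets orbT.
exact: leq_sum.
Qed.

Section Flags.

Variable n : nat.
Implicit Types (A B : {set 'I_n}) (C F G X : {set {set 'I_n}}) (s : 'S_n).

Lemma cardsC_ord A : #|A| + #|~: A| = n.
Proof. by rewrite cardsC card_ord. Qed.

Lemma card_set_ord A : #|A| <= n.
Proof. by rewrite -[leqRHS]card_ord max_card. Qed.

Definition initial_set j := [set x : 'I_n | x < j].

Lemma card_initial_set j : j <= n -> #|initial_set j| = j.
Proof.
move=> le_jn; rewrite -sum1dep_card -(big_ord_widen n (fun=> 1)) //.
by rewrite sum1_card card_ord.
Qed.

Definition flag s : {set {set 'I_n}} :=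
  [set A : {set 'I_n} | s @: A == initial_set #|A|].

Lemma flag_chain s : chain (flag s).
Proof.
have sub : {in flag s &, forall A B : {set 'I_n}, #|A| <= #|B| -> A \subset B}.
  move=> A B; rewrite !inE => /eqP sA /eqP sB le_AB; apply/subsetP => x inA.
  rewrite -(mem_imset _ _ (@perm_inj _ s)) sB inE (leq_trans _ le_AB) //.
  by have := imset_f s inA; rewrite sA inE.
apply/chainP => A B inA inB.
by case/orP: (leq_total #|A| #|B|) => /sub->; rewrite ?orbT.
Qed.

Definition flag_set s j := (s^-1)%g @: initial_set j.

Lemma card_flag_set s j : j <= n -> #|flag_set s j| = j.
Proof.
by move=> le_jn; rewrite card_imset ?card_initial_set //; apply: perm_inj.
Qed.

Lemma mem_flag_set s j : j <= n -> flag_set s j \in flag s.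
Proof.
move=> le_jn; rewrite inE card_flag_set // -imset_comp.
by rewrite (eq_imset (g := id)) ?imset_id // => x; rewrite /= permKV.
Qed.

Lemma leq_card_flag_range s lo hi : hi <= n.+1 ->
  hi - lo <= #|[set A : {set 'I_n} in flag s | lo <= #|A| < hi]|.
Proof.
move=> le_hin; have le_n (j : 'I_(hi - lo)) : lo + j <= n.
  by have := ltn_ord j; lia.
have flag_set_inj : injective (fun j : 'I_(hi - lo) => flag_set s (lo + j)).
  move=> i j /(congr1 (fun A : {set 'I_n} => #|A|)).
  by rewrite !card_flag_set // => /addnI/val_inj.
rewrite -[leqLHS]card_ord -(card_imset _ flag_set_inj) subset_leq_card //.
apply/subsetP => _ /imsetP[j _ ->].
by rewrite inE mem_flag_set ?card_flag_set //=; have := ltn_ord j; lia.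
Qed.

Lemma flags_through_rcoset C s0 : C \subset flag s0 ->
  [set s | C \subset flag s] = ('C(C | 'P^* ) :* s0)%g.
Proof.
move=> /subsetP C0; apply/setP => s; rewrite inE mem_rcoset.
apply/subsetP/astabP => [Cs A inA | fixC A inA].
  move: (Cs A inA) (C0 A inA); rewrite !inE -!setact_permE => /eqP sA /eqP s0A.
  by rewrite actM sA -s0A actK.
move: (C0 A inA); rewrite !inE -!setact_permE => /eqP <-.
by rewrite -{2}(fixC A inA) -actM mulgKV.
Qed.

Lemma leq_card_flags_through C :
  #|[set s | C \subset flag s]| <= #|('C(C | 'P^* ))%g|.
Proof.
have [-> | [s0]] := set_0Vmem [set s | C \subset flag s]; first by rewrite cards0.
by rewrite inE => /flags_through_rcoset->; rewrite card_rcoset.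
Qed.

Lemma card_flags_through1 A : #|[set s | A \in flag s]| = #|A|`! * (n - #|A|)`!.
Proof.
have /orbitP[s _ sA] : initial_set #|A| \in orbit 'P^* [set: 'S_n] A.
  by rewrite orbit_set_perm inE card_initial_set ?card_set_ord.
under eq_finset do rewrite -sub1set.
rewrite (@flags_through_rcoset _ s) ?card_rcoset ?card_astab1_set ?card_ord //.
by rewrite sub1set inE -sA.
Qed.

Definition flag_weight i := if i is j.+1 then 'C(n, i) - 'C(n, j) else 1.

Lemma sum_flag_weight m : m.*2 <= n -> \sum_(i < m.+1) flag_weight i = 'C(n, m).
Proof.
elim: m => [|m IHm] le_mn; first by rewrite big_ord1 /= bin0.
rewrite big_ord_recr /= IHm; last by lia.
by rewrite subnKC // leq_binS //; lia.
Qed.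

Lemma sum_flag_weight_range a : a <= n ->
  \sum_(i < n./2.+1 | i <= a <= n - i) flag_weight i = 'C(n, a).
Proof.
move=> le_an; set m := minn a (n - a).
have -> : 'C(n, a) = 'C(n, m) by rewrite /m; case: leqP => // _; rewrite bin_sub.
rewrite -sum_flag_weight; last by rewrite /m; lia.
rewrite (big_ord_widen n./2.+1); last by rewrite /m; lia.
by apply: eq_bigl => i; have := ltn_ord i; rewrite /m; lia.
Qed.

Definition truncated_flag s i : {set {set 'I_n}} :=
  [set A : {set 'I_n} in flag s | i <= #|A| <= n - i].

Lemma truncated_flag_cover A :
  \sum_(p : 'S_n * 'I_n./2.+1 | A \in truncated_flag p.1 p.2) flag_weight p.2 = n`!.
Proof.
have le_An := card_set_ord A.
transitivity (\sum_(s | A \in flag s)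
    \sum_(i < n./2.+1 | i <= #|A| <= n - i) flag_weight i).
  by rewrite pair_big; apply: eq_bigl => p; rewrite inE.
rewrite sum_flag_weight_range // sum_nat_const mulnC.
by rewrite -(bin_fact le_An) -card_flags_through1 cardsE.
Qed.

Lemma truncated_flag_weight_le C A : A \in C ->
  \sum_(p : 'S_n * 'I_n./2.+1 | C \subset truncated_flag p.1 p.2) flag_weight p.2
    <= #|('C(C | 'P^* ))%g| * 'C(n, #|A|).
Proof.
move=> inA.
apply: leq_trans (_ : \sum_(s | C \subset flag s)
    \sum_(i < n./2.+1 | i <= #|A| <= n - i) flag_weight i <= _).
  rewrite pair_big big_mkcond [leqRHS]big_mkcond; apply: leq_sum => -[s i] _ /=.
  case: ifP => // /subsetP sC; have := sC A inA; rewrite inE => /andP[_ ->].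
  rewrite andbT; case: ifP => // /negP[]; apply/subsetP => B /sC.
  by rewrite inE => /andP[].
rewrite sum_flag_weight_range ?card_set_ord // sum_nat_const leq_mul //.
by have := leq_card_flags_through C; rewrite cardsE.
Qed.

Lemma in_Bfloor k A : k <= n ->
  (A \in Bfloor n k) = ((n.+1 - k)./2 <= #|A| < (n + k.+1)./2).
Proof. by move=> le_kn; rewrite inE /floor_half; apply/idP/idP; lia. Qed.

Lemma truncated_flag_middle k s i : k <= n ->
  (truncated_flag s i \subset Bfloor n k)
  || (k <= #|Bfloor n k :&: truncated_flag s i|).
Proof.
move=> le_kn.
have [short|long] := boolP (((n.+1 - k)./2 <= i) && (n - i < (n + k.+1)./2)).
  apply/orP; left; apply/subsetP => A; rewrite inE in_Bfloor // => /andP[_].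
  by lia.
apply/orP; right.
apply: leq_trans (_ : (n + k.+1)./2 - (n.+1 - k)./2 <= _); first by lia.
apply: leq_trans (leq_card_flag_range s _ _) _; first by lia.
apply/subset_leq_card/subsetP => A; rewrite inE => /andP[sA inM].
by rewrite in_setI in_Bfloor // inM inE sA; lia.
Qed.

Lemma num_chainsE k F : num_chains k F = #|chain_copies k F|.
Proof. by []. Qed.

Lemma num_chains_ge_missing k G : k <= n -> (set0 \notin G) || (setT \notin G) ->
  (#|G| - Sigma n k) * (n + k.+1)./2 ^_ k <= num_chains k.+1 G.
Proof.
move=> le_kn missing; pose I : finType := ('S_n * 'I_n./2.+1)%type.
apply: (@leq_weighted_cover I _ (fun p => flag_weight p.2)
  (fun p => truncated_flag p.1 p.2) _ _ (chain_copies k.+1 G) n`! k).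
- exact: fact_gt0.
- exact: truncated_flag_cover.
- by move=> p; apply: truncated_flag_middle.
- move=> p C; rewrite subsetI => /andP[sCG sCp] cardC.
  apply/chain_copiesP; split=> //.
  apply: chainS (flag_chain p.1); apply: subset_trans sCp _.
  by apply/subsetP => A; rewrite inE => /andP[].
move=> C /chain_copiesP[sCG cardC chainC].
have [||A inA] := chain_light_half chainC.
- by rewrite -card_gt0 cardC.
- by case/orP: missing => /(contra (subsetP sCG _))->; rewrite ?orbT.
rewrite cardC card_ord; apply: leq_trans; rewrite leq_mul2r; apply/orP; right.
exact: truncated_flag_weight_le.
Qed.

Lemma SigmaS k : Sigma n k.+1 = Sigma n k + 'C(n, (n + k.+1)./2).
Proof.
set t := (n + k.+1)./2.
pose row := [set A : {set 'I_n} | #|A| == t].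
have card_row : #|row| = 'C(n, t) by rewrite card_draws card_ord.
rewrite /Sigma -(cardsID (Bfloor n k)) -card_row; congr (_ + _).
  congr #|pred_of_set _|; apply/setIidPr/subsetP => A.
  by rewrite !inE /floor_half; lia.
(* The new row is row t if n + k + 1 is odd, and row n - t otherwise. *)
case: (boolP (odd (n + k.+1))) => par; [|rewrite -card_compl];
  congr #|pred_of_set _|; apply/setP => A; have := cardsC_ord A;
  rewrite ?mem_compl !inE /floor_half /t; lia.
Qed.

Lemma Sigma_gtn k : n < k -> Sigma n k = #|[set: {set 'I_n}]|.
Proof.
move=> lt_nk; congr #|pred_of_set _|; apply/setP => A; have := card_set_ord A.
by rewrite !inE /floor_half; lia.
Qed.

Lemma num_chains_ge k G :
  (#|G| - Sigma n k) * (n + k.+1)./2 ^_ k <= num_chains k.+1 G.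
Proof.
have [|lt_SG] := leqP #|G| (Sigma n k); first by rewrite -subn_eq0 => /eqP->.
have le_kn : k <= n.
  rewrite leqNgt; apply: contraL lt_SG => /Sigma_gtn->.
  by rewrite -leqNgt subset_leq_card ?subsetT.
have [|] := boolP ((set0 \notin G) || (setT \notin G)).
  exact: num_chains_ge_missing.
rewrite negb_or !negbK => /andP[in0 _]; case: k le_kn lt_SG => [_ _|k lt_kn].
  by rewrite ffactn0 muln1 (leq_trans (leq_subr _ _)) ?leq_card_chain_copies1.
rewrite (cardsD1 set0 G) in0 add1n ltnS => le_SG; set G' := G :\ set0 in le_SG *.
have missing0 : (set0 \notin G') || (setT \notin G') by rewrite !inE eqxx.
apply: leq_trans (leq_card_chain_copies_set0 _ in0).
apply: leq_trans (leq_add (num_chains_ge_missing lt_kn missing0)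
                          (num_chains_ge_missing (ltnW lt_kn) missing0)).
rewrite subSn // mulSn addnC leq_add2l.
apply: leq_trans (leq_ffact_half lt_kn) _; rewrite leq_mul2r; apply/orP; right.
by rewrite (leq_trans _ (leq_sub2r _ le_SG)) // SigmaS addKn.
Qed.

(* Only one of B(n, k) and B(n, k + 1) is ambiguous, depending on parity, and
   its choice decides on which side of B1 the row B2 :\: B1 lies. *)
Lemma middle_top_layer k (B1 B2 : {set {set 'I_n}}) :
    is_middle k B1 -> is_middle k.+1 B2 ->
  top_layer k (n + k.+1)./2 B1 (B2 :\: B1) \/
  top_layer k (n + k.+1)./2 (compl B1) (compl (B2 :\: B1)).
Proof.
move=> mid1 mid2; have [par | par] := boolP (odd (n + k.+1)).
  case: mid1 => ->; [left | right]; split=> A; have := cardsC_ord A;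
    case: mid2 => defB2; rewrite ?mem_compl ?defB2 !inE /ceil_half /floor_half; lia.
case: mid2 => ->; [right | left]; split=> A; have := cardsC_ord A;
  case: mid1 => defB1; rewrite ?mem_compl ?defB1 !inE /ceil_half /floor_half; lia.
Qed.

Lemma num_chains_middle_le k (B1 B2 : {set {set 'I_n}}) X :
    is_middle k B1 -> is_middle k.+1 B2 -> X \subset B2 :\: B1 ->
  num_chains k.+1 (B1 :|: X) <= #|X| * (n + k.+1)./2 ^_ k.
Proof.
move=> mid1 mid2 /subsetP sX.
have [[lev1 levX] | [lev1 levX]] := middle_top_layer mid1 mid2.
  by apply: leq_card_chain_copies_top_layer; split=> // A /sX/levX.
rewrite num_chainsE -card_chain_copies_compl -(card_compl X) /compl imsetU.
apply: leq_card_chain_copies_top_layer; split=> // A.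
by rewrite mem_compl => /sX; rewrite -mem_compl => /levX.
Qed.

Lemma card_middle_setU k (B1 : {set {set 'I_n}}) X :
    is_middle k B1 -> [disjoint X & B1] ->
  #|B1 :|: X| = #|X| + Sigma n k.
Proof.
move=> mid1; rewrite disjoint_sym -leq_card_setU => /eqP->.
by rewrite (is_middle_card mid1) addnC.
Qed.

End Flags.

Lemma prodz_ffact (t k : nat) :
  (\prod_(1 <= i < k.+1) (t%:Z - i%:Z + 1) = (t ^_ k)%:Z)%R.
Proof.
elim: k => [|k IHk]; first by rewrite big_geq.
rewrite big_nat_recr //= IHk ffactnSr.
case: (leqP k t) => [le_kt | lt_tk]; last by rewrite ffact_small // mul0r.
by rewrite PoszM; congr (_ * _)%R; lia.
Qed.

Local Open Scope ring_scope.

Theorem mainTheorem2 (n k x : nat) (hn : (0 < n)%N) (hk : (0 < k)%N)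
    (hx : (x <= binz n ((n %/ 2)%N%:Z + (-1) ^+ k * (k %/ 2)%N%:Z))%N)
    (B1 B2 X F : {set {set 'I_n}})
    (hB1 : is_middle (k - 1)%N B1) (hB2 : is_middle k B2)
    (hX : X \subset B2 :\: B1) (hXx : #|X| = x)
    (hF : F = B1 :|: X) :
  [/\ #|F| = (x + Sigma n (k - 1))%N,
      (num_chains k F)%:Z
        = x%:Z * \prod_(1 <= i < k) (((n + k) %/ 2)%N%:Z - i%:Z + 1)
    & forall G : {set {set 'I_n}}, #|G| = (x + Sigma n (k - 1))%N ->
        (num_chains k F <= num_chains k G)%N].
Proof.
case: k hk hx hB1 hB2 => // k _ _; rewrite subSS subn0 => mid1 mid2.
have cardF : #|F| = (x + Sigma n k)%N.
  rewrite hF -hXx; apply: card_middle_setU mid1 _.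
  by move: hX; rewrite subsetD => /andP[].
have upper : (num_chains k.+1 F <= x * (n + k.+1)./2 ^_ k)%N.
  by rewrite hF -hXx (num_chains_middle_le mid1 mid2).
have lower (G : {set {set 'I_n}}) : #|G| = (x + Sigma n k)%N ->
    (x * (n + k.+1)./2 ^_ k <= num_chains k.+1 G)%N.
  by move=> cardG; have := num_chains_ge k G; rewrite cardG addnK.
split=> // [|G /lower]; last exact: leq_trans.
rewrite divn2 prodz_ffact -PoszM; congr Posz.
by apply/eqP; rewrite eqn_leq upper lower.
Qed.
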